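(* Consider, for each log-concave probability mass function $\pi$ on $\{0,\ldots,n\}$, the discrete-time birth-and-death chain $X^{(\pi)}$ with kernel $K_\pi$ and initial state $0$. Among these chains, the one with $\pi$ uniform (the uniform chain $U$) is slowest to mix in separation: for every log-concave $\pi$ and every $t=0,1,2,\ldots$, $\mathrm{sep}_{X^{(\pi)}}(t)\le\mathrm{sep}_U(t)$.
   Context: $n$ is a positive integer. Throughout, $\pi_i>0$ for all $i\in\{0,\ldots,n\}$; log-concave means $\pi_i^2\ge\pi_{i-1}\pi_{i+1}$ for $0<i<n$. For log-concave $\pi$, $K_\pi$ is the birth-and-death kernel on $\{0,\ldots,n\}$ with (death, hold, birth) probabilities $K_\pi(i,i-1)=q_i$, $K_\pi(i,i)=r_i$, $K_\pi(i,i+1)=p_i$, where $$q_i=\frac{\pi_{i-1}}{\pi_{i-1}+\pi_i},\qquad r_i=\frac{\pi_i^2-\pi_{i-1}\pi_{i+1}}{(\pi_{i-1}+\pi_i)(\pi_i+\pi_{i+1})},\qquad p_i=\frac{\pi_{i+1}}{\pi_i+\pi_{i+1}},$$ with $\pi_{-1}:=0$ and $\pi_{n+1}:=0$; its stationary distribution is $\pi$. (It is the fastest-mixing stochastically monotone birth-and-death chain with stationary distribution $\pi$ started at $0$.) When $\pi$ is uniform, $K_\pi$ has transition probability $1/2$ in each direction along each edge $\{i,i+1\}$ and holding probability $1/2$ at $0$ and at $n$; this is the uniform chain $U$ (started at $0$). The separation of a chain $X$ with stationary distribution $\pi$ is $\mathrm{sep}_X(t)=\max_i\left[1-\mathbf{P}(X_t=i)/\pi_i\right]$;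 each chain's separation is computed relative to its own stationary distribution. *)

(* Defs.v *)
From HB Require Import structures.
From mathcomp Require Import all_boot all_order all_algebra.
From mathcomp Require Import ring.

Set Implicit Arguments.
Unset Strict Implicit.
Unset Printing Implicit Defensive.

Import Order.TTheory GRing.Theory Num.Theory.
Local Open Scope ring_scope.

Definition pos_pmf (R : realFieldType) (n : nat) (pi : 'rV[R]_n.+1) : Prop :=
  (forall i : 'I_n.+1, 0 < pi 0 i) /\ \sum_(i < n.+1) pi 0 i = 1.

(* pi_{i-1} and pi_{i+1}, with the conventions pi_{-1} = pi_{n+1} = 0. *)
Definition pi_prev (R : realFieldType) (n : nat) (pi : 'rV[R]_n.+1)
    (i : 'I_n.+1) : R :=
  if (0 < i)%N then pi 0 (inord i.-1) else 0.

Definition pi_next (R : realFieldType) (n : nat) (pi : 'rV[R]_n.+1)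
    (i : 'I_n.+1) : R :=
  if (i < n)%N then pi 0 (inord i.+1) else 0.

Definition log_concave (R : realFieldType) (n : nat) (pi : 'rV[R]_n.+1)
    : Prop :=
  forall i : 'I_n.+1, (0 < i < n)%N -> pi_prev pi i * pi_next pi i <= pi 0 i ^+ 2.

Definition death (R : realFieldType) (n : nat) (pi : 'rV[R]_n.+1)
    (i : 'I_n.+1) : R :=
  pi_prev pi i / (pi_prev pi i + pi 0 i).

Definition hold (R : realFieldType) (n : nat) (pi : 'rV[R]_n.+1)
    (i : 'I_n.+1) : R :=
  (pi 0 i ^+ 2 - pi_prev pi i * pi_next pi i) /
  ((pi_prev pi i + pi 0 i) * (pi 0 i + pi_next pi i)).

Definition birth (R : realFieldType) (n : nat) (pi : 'rV[R]_n.+1)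
    (i : 'I_n.+1) : R :=
  pi_next pi i / (pi 0 i + pi_next pi i).

Definition bd_kernel (R : realFieldType) (n : nat) (pi : 'rV[R]_n.+1)
    : 'M[R]_n.+1 :=
  \matrix_(i < n.+1, j < n.+1)
    if (j.+1 == i :> nat)%N then death pi i
    else if j == i then hold pi i
    else if (j == i.+1 :> nat)%N then birth pi i
    else 0.

(* Distributions are row vectors: (chain_law K x t) 0 i is P(X_t = i) for the
   Markov chain X with kernel K and X_0 = x. *)
Definition chain_law (R : realFieldType) (n : nat) (K : 'M[R]_n.+1)
    (x : 'I_n.+1) (t : nat) : 'rV[R]_n.+1 :=
  delta_mx 0 x *m K ^+ t.

(* The neutral value of the iterated maximum is one of the terms, so this is
   the maximum over the nonempty state space. *)
Definition separation (R : realFieldType) (n : nat) (mu pi : 'rV[R]_n.+1) : R :=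
  \big[Num.max/1 - mu 0 ord0 / pi 0 ord0]_(i < n.+1) (1 - mu 0 i / pi 0 i).

Definition sep_chain (R : realFieldType) (n : nat) (pi : 'rV[R]_n.+1)
    (t : nat) : R :=
  separation (chain_law (bd_kernel pi) ord0 t) pi.

Definition uniform_pmf (R : realFieldType) (n : nat) : 'rV[R]_n.+1 :=
  const_mx (n.+1%:R^-1).

Lemma uniform_pos_pmf (R : realFieldType) (n : nat) :
  pos_pmf (uniform_pmf R n).
Proof.
split=> [i|]; first by rewrite mxE invr_gt0 ltr0n.
under eq_bigr do rewrite mxE.
by rewrite sumr_const card_ord -[LHS]mulr_natr mulVf // pnatr_eq0.
Qed.

Lemma uniform_log_concave (R : realFieldType) (n : nat) :
  log_concave (uniform_pmf R n).
Proof.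
by move=> i /andP[i0 ilt]; rewrite /pi_prev /pi_next i0 ilt !mxE -expr2.
Qed.

(* Every edge of the path has transition probability 1/2 in each direction,
   and the holding probability is 1/2 at both ends and 0 elsewhere. *)
Lemma uniform_bd_kernelE (R : realFieldType) (n : nat) (i j : 'I_n.+1) :
  (0 < n)%N ->
  bd_kernel (uniform_pmf R n) i j =
    if [|| (j.+1 == i :> nat)%N, (j == i.+1 :> nat)%N
         | (j == i) && ((i == 0 :> nat)%N || (i == n :> nat)%N)]
    then 2^-1 else 0.
Proof.
move=> n0; rewrite mxE /death /hold /birth /pi_prev /pi_next !mxE.
have c0 : (n.+1%:R : R)^-1 != 0 by rewrite invr_eq0 pnatr_eq0.
move: (n.+1%:R^-1) c0 => c c0.
have ile := ltn_ord i; have jle := ltn_ord j.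
have half : c / (c + c) = 2^-1.
  by rewrite -[c + c]mulr2n -[c *+ 2]mulr_natr invfM [LHS]mulrA mulfV // mul1r.
have half2 : c ^+ 2 / (c * (c + c)) = 2^-1.
  by rewrite expr2 invfM mulrACA mulfV // mul1r.
case: eqP => [e1|_] /=; first by rewrite -e1 half.
case: (j =P i) => [->|ne] /=.
  rewrite (ltn_eqF (ltnSn i)) /=.
  case: (posnP i) => [->|i0]; first by rewrite n0 /= mul0r subr0 add0r half2.
  case: (ltnP i n) => [iltn|nlei].
    rewrite (ltn_eqF iltn) /=.
    by rewrite -expr2 subrr mul0r.
  have -> : (i == n :> nat) by rewrite eqn_leq nlei -ltnS ile.
  by rewrite mulr0 subr0 addr0 [(c + c) * c]mulrC half2.
rewrite orbF; case: eqP => // e2.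
by rewrite -ltnS -e2 jle half.
Qed.

Lemma pi_prev_ge0 (R : realFieldType) (n : nat) (pi : 'rV[R]_n.+1)
    (i : 'I_n.+1) :
  (forall k, 0 < pi 0 k) -> 0 <= pi_prev pi i.
Proof. by move=> pi_gt0; rewrite /pi_prev; case: ifP => // _; exact: ltW. Qed.

Lemma pi_next_ge0 (R : realFieldType) (n : nat) (pi : 'rV[R]_n.+1)
    (i : 'I_n.+1) :
  (forall k, 0 < pi 0 k) -> 0 <= pi_next pi i.
Proof. by move=> pi_gt0; rewrite /pi_next; case: ifP => // _; exact: ltW. Qed.

Lemma bd_kernel_ge0 (R : realFieldType) (n : nat) (pi : 'rV[R]_n.+1)
    (i j : 'I_n.+1) :
  pos_pmf pi -> log_concave pi -> 0 <= bd_kernel pi i j.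
Proof.
move=> [pi_gt0 _] lc; rewrite mxE.
have a0 := pi_prev_ge0 i pi_gt0; have c0 := pi_next_ge0 i pi_gt0.
have b0 := ltW (pi_gt0 i).
case: ifP => _; first by rewrite divr_ge0 // addr_ge0.
case: ifP => _; last first.
  by case: ifP => // _; rewrite divr_ge0 // addr_ge0.
apply: divr_ge0; last by rewrite mulr_ge0 ?addr_ge0.
rewrite subr_ge0.
case: (boolP (0 < i < n)%N) => [/lc //|].
rewrite negb_and /pi_prev /pi_next => /orP[/negPf -> | /negPf ->].
  by rewrite mul0r sqr_ge0.
by rewrite mulr0 sqr_ge0.
Qed.

Lemma bd_kernel_row_sum (R : realFieldType) (n : nat) (pi : 'rV[R]_n.+1)
    (i : 'I_n.+1) :
  pos_pmf pi -> \sum_j bd_kernel pi i j = 1.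
Proof.
move=> [pi_gt0 _].
have a0 := pi_prev_ge0 i pi_gt0; have c0 := pi_next_ge0 i pi_gt0.
have b0 := pi_gt0 i; have ile := ltn_ord i.
have step (j : 'I_n.+1) : bd_kernel pi i j =
    (if (j.+1 == i :> nat)%N then death pi i else 0) +
    ((if j == i then hold pi i else 0) +
     (if (j == i.+1 :> nat)%N then birth pi i else 0)).
  rewrite mxE; case: (j.+1 =P i :> nat) => [e|_].
    rewrite -val_eqE /= -e (ltn_eqF (ltnSn j)) (ltn_eqF (leqnSn j.+1)).
    by rewrite !addr0.
  case: (j =P i) => [->|_]; last by rewrite !add0r.
  by rewrite (ltn_eqF (ltnSn i)) addr0 add0r.
rewrite (eq_bigr _ (fun j _ => step j)) !big_split /= -!big_mkcond /=.
rewrite big_pred1_eq.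
have -> : \sum_(j < n.+1 | j.+1 == i :> nat) death pi i = death pi i.
  case: (posnP i) => [e|i0].
    rewrite big_pred0 => [|j]; last by rewrite e.
    by rewrite /death /pi_prev e mul0r.
  rewrite (big_pred1 (inord i.-1)) // => j.
  rewrite /= -val_eqE /= inordK; last by rewrite prednK // ltnW.
  by rewrite -{1}(prednK i0) eqSS.
have -> : \sum_(j < n.+1 | j == i.+1 :> nat) birth pi i = birth pi i.
  case: (ltnP i n) => [iltn|nlei].
    by rewrite (big_pred1 (inord i.+1)) // => j; rewrite /= -val_eqE /= inordK.
  rewrite big_pred0 => [|j].
    by rewrite /birth /pi_next ltnNge nlei mul0r.
  by apply/negbTE; rewrite neq_ltn (leq_trans (ltn_ord j)).
rewrite /death /hold /birth; field.
apply/andP; split; apply: lt0r_neq0; first exact: ltr_wpDr.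
exact: ltr_wpDl.
Qed.

Lemma bd_kernel_reversible (R : realFieldType) (n : nat) (pi : 'rV[R]_n.+1)
    (i j : 'I_n.+1) :
  pi 0 i * bd_kernel pi i j = pi 0 j * bd_kernel pi j i.
Proof.
wlog le_ij : i j / (i <= j)%N.
  by move=> H; case: (leqP i j) => [|/ltnW] /H.
move: le_ij; rewrite leq_eqVlt => /orP[/eqP/val_inj -> //|lt_ij].
rewrite !mxE (gtn_eqF (ltn_trans lt_ij (ltnSn j))) -!val_eqE /=.
rewrite (gtn_eqF lt_ij) (ltn_eqF lt_ij) (ltn_eqF (ltn_trans lt_ij (ltnSn j))).
rewrite [(i.+1 == j)%N]eq_sym; case: eqP => [e|_]; last by rewrite !mulr0.
have iltn : (i < n)%N by rewrite -ltnS -e.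
rewrite /birth /death /pi_prev /pi_next iltn e /= inord_val -e inord_val.
by rewrite mulrCA.
Qed.

Lemma bd_kernel_stationary (R : realFieldType) (n : nat) (pi : 'rV[R]_n.+1) :
  pos_pmf pi -> pi *m bd_kernel pi = pi.
Proof.
move=> pi_pmf; apply/rowP => j; rewrite mxE.
under eq_bigr do rewrite bd_kernel_reversible.
by rewrite -mulr_sumr bd_kernel_row_sum // mulr1.
Qed.

(* Main.v *)
Require Import Defs.
From HB Require Import structures.
From mathcomp Require Import all_boot all_order all_algebra.
From mathcomp Require Import ring lra zify.
Import Order.TTheory GRing.Theory Num.Theory.
Local Open Scope ring_scope.

(** The proof compares strong stationary duals.  Write [H_i] for the mass that
    [pi] gives to [{0, ..., i}], and let [link] be the kernel sending [i] to
    [pi] conditioned on [{0, ..., i}].  For a monotone birth-and-death kernel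
    [K], there is a dual kernel [P] with [link * K = P * link]: it is the
    Siegmund dual of [K], conjugated by [H].  Since [p_i + q_(i+1) = 1] for the
    kernels considered here, this dual never holds: it moves by one step up or
    down until it is absorbed at [n].  Its probability of moving up from [i] is
    [dual_up], that is [(H_(i+1) / H_i) * pi_i / (pi_i + pi_(i+1))].

    Row [0] of [link] is the point mass at [0], so the law of the chain at time
    [t] is the law of the dual at time [t], started at [0], pushed through
    [link].  Hence [P(X_t = k) / pi_k] is a sum over [i >= k] of nonnegative
    terms; it is smallest at [k = n], where it is the probability that the dual
    has been absorbed.  So the separation is the probability that the dual is
    not yet absorbed ([sep_chain_hit]).

    It remains to see that the dual of the uniform chain is the slowest.

    - Its up-probability at [i] is [(i + 2) / (2 (i + 1))], and log-concavity
      makes every other dual at least as likely to move up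
      ([dual_up_log_concave]).  Indeed [1 - dual_up] increases with [H_(i-1)],
      and log-concavity bounds [pi_(i-k)] by the geometric weights
      [pi_i * x ^ k] with [x = pi_i / pi_(i+1)]; for these the bound is the sum
      over [k] of [x ^ k + x ^ (i+1-k) <= 1 + x ^ (i+1)].

    - Two walks without holding that start together always have positions of
      the same parity, so the one that is more likely to move up cannot be
      overtaken without meeting the other.  The analytic form of this coupling
      is that the hitting probability of [n] is monotone along steps of two
      ([hit_mono2]), from which comparison of the up-probabilities gives
      comparison of the hitting probabilities ([hit_le]). *)

(** * Hitting probabilities of nearest-neighbour chains without holding *)

(** The probability that the walk on the naturals with up-probabilities [p] and
    down-probabilities [1 - p], started at [i], has reached [n] by time [t].
    For [i = 0] the truncated predecessor is harmless when [p 0 = 1]. *)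
Fixpoint hit {R : realFieldType} (n : nat) (p : nat -> R) (t i : nat) : R :=
  if (n <= i)%N then 1
  else if t is s.+1 then p i * hit n p s i.+1 + (1 - p i) * hit n p s i.-1
  else 0.

Lemma hit_absorbed {R : realFieldType} (n : nat) (p : nat -> R) (t i : nat) :
  (n <= i)%N -> hit n p t i = 1.
Proof. by case: t => [|t] /= ->. Qed.

Lemma hitS {R : realFieldType} (n : nat) (p : nat -> R) (t i : nat) :
  (i < n)%N ->
  hit n p t.+1 i = p i * hit n p t i.+1 + (1 - p i) * hit n p t i.-1.
Proof. by move=> lt_in /=; rewrite leqNgt lt_in. Qed.

Lemma hit_bounds {R : realFieldType} (n : nat) (p : nat -> R) (t i : nat) :
  (forall j, (j < n)%N -> 0 <= p j <= 1) -> 0 <= hit n p t i <= 1.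
Proof.
move=> p01; elim: t i => [|t IH] i; case: (leqP n i) => [le_ni|lt_in].
- by rewrite hit_absorbed // ler01 lexx.
- by rewrite /= leqNgt lt_in lexx ler01.
- by rewrite hit_absorbed // ler01 lexx.
- rewrite hitS //; move: (p01 i lt_in) (IH i.+1) (IH i.-1).
  move=> /andP[? ?] /andP[? ?] /andP[? ?]; apply/andP; split; nra.
Qed.

(** Starting two steps higher helps, because from [i + 2] both neighbours are at
    least [i + 1] and from [i] both are at most [i + 1]. *)
Lemma hit_mono2 {R : realFieldType} (n : nat) (p : nat -> R) (t i : nat) :
  (forall j, (j < n)%N -> 0 <= p j <= 1) -> p 0%N = 1 ->
  hit n p t i <= hit n p t i.+2.
Proof.
move=> p01 p0; elim: t i => [|t IH] i.
  by rewrite /=; do 2![case: ifP] => // /idP h /idP; lia.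
case: (leqP n i.+2) => [le_n|lt_n].
  by rewrite [leRHS]hit_absorbed //; case/andP: (hit_bounds n p t.+1 i p01).
have lt_in : (i < n)%N by lia.
rewrite !hitS //=.
apply: (@le_trans _ _ (hit n p t i.+1)).
  case: i lt_n lt_in => [|i] lt_n lt_in; first by rewrite p0; lra.
  by move: (p01 _ lt_in) (IH i) => /andP[? ?] ? /=; nra.
by move: (p01 _ lt_n) (IH i.+1) => /andP[? ?] ?; nra.
Qed.

(** The first step trades weight between [i - 1] and [i + 1], which is favourable
    by [hit_mono2]; the remaining steps are compared by induction. *)
Lemma hit_le {R : realFieldType} (n : nat) (p p' : nat -> R) (t i : nat) :
  (forall j, (j < n)%N -> 0 <= p j <= 1) ->
  (forall j, (j < n)%N -> 0 <= p' j <= 1) -> p 0%N = 1 -> p' 0%N = 1 ->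
  (forall j, (j < n)%N -> p j <= p' j) ->
  hit n p t i <= hit n p' t i.
Proof.
move=> p01 p'01 p0 p'0 le_pp'; elim: t i => [|t IH] i //.
case: (leqP n i) => [le_ni|lt_in]; first by rewrite !hit_absorbed.
rewrite !hitS //; case: i lt_in => [|i] lt_in.
  by rewrite p0 p'0; have := IH 1%N; lra.
have := IH i.+2; have := IH i; have := hit_mono2 n p t i p01 p0.
move: (p'01 _ lt_in) (le_pp' _ lt_in) => /andP[? ?] ? ? ? ? /=; nra.
Qed.

(** The walk stopped at [n], as a matrix on [{0, ..., n}].  Row [0] has no
    room for a downward step, so that it is stochastic only if [p 0 = 1]. *)
Definition walk_mx {R : realFieldType} (n : nat) (p : nat -> R) : 'M[R]_n.+1 :=
  \matrix_(i < n.+1, l < n.+1)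
    if i == n :> nat then (l == n :> nat)%:R
    else if l == i.+1 :> nat then p i
    else if l.+1 == i :> nat then 1 - p i
    else 0.

Lemma walk_mx_sum {R : realFieldType} (n : nat) (p : nat -> R)
    (i : 'I_n.+1) (F : nat -> R) : p 0%N = 1 -> (i < n)%N ->
  \sum_l walk_mx n p i l * F l = p i * F i.+1 + (1 - p i) * F i.-1.
Proof.
move=> p0 lt_in.
have ltSi : (i.+1 < n.+1)%N by [].
rewrite (bigD1 (Ordinal ltSi)) //= mxE (ltn_eqF lt_in) /= eqxx; congr (_ + _).
case: (posnP i) => [i0|i_gt0].
  rewrite [in RHS]i0 p0 subrr mul0r big1 // => l.
  rewrite -val_eqE /= => /negPf lNS.
  by rewrite mxE (ltn_eqF lt_in) lNS i0 mul0r.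
have ltPi : (i.-1 < n.+1)%N by lia.
rewrite (bigD1 (Ordinal ltPi)) -?val_eqE /=; last by apply/eqP; lia.
rewrite mxE (ltn_eqF lt_in) /= prednK // eqxx.
have -> /= : (i.-1 == i.+1) = false by apply/eqP; lia.
rewrite big1 ?addr0 // => l; rewrite -!val_eqE /= => /andP[/negPf lNS lNP].
rewrite mxE (ltn_eqF lt_in) lNS.
by have -> : (l.+1 == i) = false; [move/eqP: lNP => ?; apply/eqP; lia|rewrite mul0r].
Qed.

Lemma walk_mx_last {R : realFieldType} (n : nat) (p : nat -> R)
    (F : 'I_n.+1 -> R) :
  \sum_l walk_mx n p ord_max l * F l = F ord_max.
Proof.
rewrite (bigD1 ord_max) //= mxE /= !eqxx mul1r big1 ?addr0 // => l.
by rewrite -val_eqE mxE /= eqxx => /negPf ->; rewrite mul0r.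
Qed.

Lemma walk_mx_hit {R : realFieldType} (n : nat) (p : nat -> R) (t : nat)
    (i : 'I_n.+1) : p 0%N = 1 ->
  (walk_mx n p ^+ t) i ord_max = hit n p t i.
Proof.
move=> p0; elim: t i => [|t IH] i.
  rewrite expr0 mxE -val_eqE /=.
  have -> : (i == n :> nat) = (n <= i)%N by have := ltn_ord i; lia.
  by case: ifP.
rewrite exprS mxE; under eq_bigr do rewrite IH.
case: (ltnP i n) => [lt_in|le_ni].
  by rewrite (walk_mx_sum n p i (hit n p t)) // hitS.
have -> : i = ord_max by apply: val_inj; have := ltn_ord i; rewrite /=; lia.
by rewrite walk_mx_last !hit_absorbed.
Qed.

Lemma walk_mx_exp_ge0 {R : realFieldType} (n : nat) (p : nat -> R) (t : nat)
    (i l : 'I_n.+1) : (forall j, (j < n)%N -> 0 <= p j <= 1) ->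
  0 <= (walk_mx n p ^+ t) i l.
Proof.
move=> p01; elim: t i l => [|t IH] i l; first by rewrite expr0 mxE ler0n.
rewrite exprS mxE sumr_ge0 // => k _; apply: mulr_ge0 => //.
rewrite mxE; case: eqP => [_|ne]; first exact: ler0n.
have /p01/andP[? ?] : (i < n)%N by have := ltn_ord i; lia.
by case: ifP => // _; case: ifP; rewrite ?subr_ge0.
Qed.

(** * The up-probabilities of the dual chain *)

Definition cum {R : realFieldType} (w : nat -> R) (i : nat) : R :=
  \sum_(j < i) w j.

Definition dual_up {R : realFieldType} (w : nat -> R) (i : nat) : R :=
  cum w i.+2 / cum w i.+1 * (w i / (w i + w i.+1)).

Lemma cum0 {R : realFieldType} (w : nat -> R) : cum w 0 = 0.
Proof. exact: big_ord0. Qed.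

Lemma cumS {R : realFieldType} (w : nat -> R) (i : nat) :
  cum w i.+1 = cum w i + w i.
Proof. exact: big_ord_recr. Qed.

Lemma cum_ge0 {R : realFieldType} (w : nat -> R) (i : nat) :
  (forall j, 0 < w j) -> 0 <= cum w i.
Proof. by move=> w_gt0; apply: sumr_ge0 => j _; exact: ltW. Qed.

Lemma cumS_gt0 {R : realFieldType} (w : nat -> R) (i : nat) :
  (forall j, 0 < w j) -> 0 < cum w i.+1.
Proof. by move=> w_gt0; rewrite cumS ltr_wpDl // cum_ge0. Qed.

Lemma dual_upC {R : realFieldType} (w : nat -> R) (i : nat) :
  (forall j, 0 < w j) ->
  1 - dual_up w i = cum w i / cum w i.+1 * (w i.+1 / (w i + w i.+1)).
Proof.
move=> w_gt0; have a0 := w_gt0 i; have b0 := w_gt0 i.+1.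
have := cumS_gt0 w i w_gt0; rewrite /dual_up !cumS => c0; field.
by rewrite !lt0r_neq0 // addr_gt0.
Qed.

Lemma dual_up_bounds {R : realFieldType} (w : nat -> R) (i : nat) :
  (forall j, 0 < w j) -> 0 <= dual_up w i <= 1.
Proof.
move=> w_gt0; rewrite -[_ <= 1]subr_ge0 dual_upC // /dual_up.
by rewrite !(mulr_ge0, invr_ge0, addr_ge0, cum_ge0) // ltW.
Qed.

Lemma dual_up0 {R : realFieldType} (w : nat -> R) :
  (forall j, 0 < w j) -> dual_up w 0 = 1.
Proof.
move=> w_gt0; apply/esym/eqP; rewrite -subr_eq0 dual_upC // cum0.
by rewrite !mul0r.
Qed.

(** This is the cross-multiplied form of the fact that the ratios [w j.+1 / w j]
    decrease along a log-concave sequence. *)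
Lemma log_concave_ratio {R : realFieldType} (w : nat -> R) (n i j : nat) :
  (forall k, 0 < w k) ->
  (forall k, (k.+2 <= n)%N -> w k * w k.+2 <= w k.+1 ^+ 2) ->
  (j <= i)%N -> (i < n)%N -> w j * w i.+1 <= w j.+1 * w i.
Proof.
move=> w_gt0 lc; elim: i => [|i IH] le_ji lt_in.
  by rewrite leqn0 in le_ji; rewrite (eqP le_ji) mulrC.
move: le_ji; rewrite leq_eqVlt => /orP[/eqP->|le_ji]; first by rewrite mulrC.
rewrite -(ler_pM2r (w_gt0 i)).
have := IH le_ji (ltnW lt_in); have := lc i lt_in.
have := w_gt0 i.+2; have := w_gt0 i.+1; have := w_gt0 j.+1.
set a := w j; set a' := w j.+1; set b := w i; set c := w i.+1; set d := w i.+2.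
move=> a'0 c0 d0 lc_i IHi; apply: (@le_trans _ _ (a * c * c)).
  by have := w_gt0 j; rewrite -/a; nra.
by rewrite mulrAC; nra.
Qed.

(** Pair each power with its mirror image:
    [x ^ a + x ^ b <= 1 + x ^ (a + b)], because [1 - x ^ a] and [1 - x ^ b] have
    the same sign. *)
Lemma sum_geom_le {R : realFieldType} (x : R) (i : nat) : 0 <= x ->
  2 * \sum_(k < i) x ^+ k.+1 <= i%:R * (1 + x ^+ i.+1).
Proof.
move=> x_ge0; rewrite mulr_natl mulr2n {2}(reindex_inj rev_ord_inj) /=.
rewrite -big_split /= mulr_natl.
have -> : (1 + x ^+ i.+1) *+ i = \sum_(k < i) (1 + x ^+ i.+1).
  by rewrite sumr_const card_ord.
apply: ler_sum => k _.
have -> : x ^+ i.+1 = x ^+ k.+1 * x ^+ (i - k.+1).+1.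
  by rewrite -exprD; congr (_ ^+ _); have := ltn_ord k; lia.
case: (lerP x 1) => [x_le1|/ltW x_ge1].
  have := exprn_ile1 k.+1 x_ge0 x_le1.
  have := exprn_ile1 (i - k.+1).+1 x_ge0 x_le1.
  by nra.
have := exprn_ege1 k.+1 x_ge1; have := exprn_ege1 (i - k.+1).+1 x_ge1.
by nra.
Qed.

Lemma log_concave_geom {R : realFieldType} (w : nat -> R) (n i k : nat) :
  (forall j, 0 < w j) ->
  (forall j, (j.+2 <= n)%N -> w j * w j.+2 <= w j.+1 ^+ 2) ->
  (k <= i)%N -> (i < n)%N -> w (i - k)%N <= w i * (w i / w i.+1) ^+ k.
Proof.
move=> w_gt0 lc; elim: k => [|k IH] lt_ki lt_in.
  by rewrite subn0 expr0 mulr1.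
have le_ki : (i - k.+1 <= i)%N by exact: leq_subr.
have := log_concave_ratio w n i (i - k.+1) w_gt0 lc le_ki lt_in.
rewrite -ler_pdivlMr // subnSK // -mulrA => /le_trans; apply.
rewrite exprSr [leRHS]mulrA; apply: ler_wpM2r; first by rewrite divr_ge0 ?ltW.
by apply: IH => //; exact: ltnW.
Qed.

Lemma cum_le_geom {R : realFieldType} (w : nat -> R) (n i : nat) :
  (forall j, 0 < w j) ->
  (forall j, (j.+2 <= n)%N -> w j * w j.+2 <= w j.+1 ^+ 2) ->
  (i < n)%N -> cum w i <= w i * \sum_(k < i) (w i / w i.+1) ^+ k.+1.
Proof.
move=> w_gt0 lc lt_in; rewrite /cum (reindex_inj rev_ord_inj) mulr_sumr /=.
by apply: ler_sum => k _; apply: (log_concave_geom w n).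
Qed.

(** With [a = w i], [b = w i.+1] and [C = cum w i], the claim reduces to
    [(i + 2) * b * C <= i * a * (a + b + C)].  Equality holds for constant
    weights. *)
Lemma dual_up_log_concave {R : realFieldType} (w : nat -> R) (n i : nat) :
  (forall j, 0 < w j) ->
  (forall j, (j.+2 <= n)%N -> w j * w j.+2 <= w j.+1 ^+ 2) ->
  (i < n)%N -> i.+2%:R / (2 * i.+1%:R) <= dual_up w i.
Proof.
move=> w_gt0 lc lt_in.
have := cum_le_geom w n i w_gt0 lc lt_in.
have := cum_ge0 w i w_gt0.
rewrite /dual_up !cumS.
have := w_gt0 i; have := w_gt0 i.+1.
set a := w i; set b := w i.+1; set C := cum w i => b0 a0 C0.
set x := a / b; set S := \sum_(k < i) _ => leC.
have x0 : 0 < x by rewrite divr_gt0.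
have leS : (i%:R + 2) * S <= i%:R * (1 + x + x * S).
  have Ex : x + x * S = S + x ^+ i.+1.
    have <- : \sum_(k < i.+1) x ^+ k.+1 = S + x ^+ i.+1 by rewrite big_ord_recr.
    rewrite big_ord_recl /=.
    by rewrite expr1 mulr_sumr; under [in RHS]eq_bigr do rewrite exprS.
  have := sum_geom_le x i (ltW x0); rewrite -/S -addrA Ex; lra.
have Ea : a = x * b by rewrite /x divfK // lt0r_neq0.
have k0 : 0 <= i%:R :> R by exact: ler0n.
have leCab : (i%:R + 2) * b * C <= i%:R * a * (a + b + C).
  rewrite Ea in leC *; set d := i%:R + 2 - i%:R * x.
  have leSd : S * d <= i%:R * (1 + x) by rewrite /d; lra.
  have xb0 : 0 < x * b by rewrite mulr_gt0.
  suff leCd : C * d <= i%:R * x * b * (1 + x).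
    by have := ler_wpM2l (ltW b0) leCd; rewrite /d /=; lra.
  (* The bound [C <= a * S] can be inserted only when its coefficient [d] is
     positive; otherwise the left-hand side is nonpositive. *)
  case: (lerP d 0) => [d_le0|d_gt0].
    apply: (@le_trans _ _ 0); first by rewrite mulr_ge0_le0.
    by apply: mulr_ge0 (mulr_ge0 (mulr_ge0 k0 (ltW x0)) (ltW b0)) (addr_ge0 ler01 (ltW x0)).
  apply: le_trans (ler_wpM2r (ltW d_gt0) leC) _.
  by have := ler_wpM2l (ltW xb0) leSd; lra.
have Ca0 : 0 < C + a by rewrite ltr_wpDl.
have ab0 : 0 < a + b by rewrite addr_gt0.
have i0 : 0 < 2 * (i%:R + 1) :> R by lra.
rewrite -(natr1 i.+1) -(natr1 i) mulf_div ler_pdivrMr // mulrAC ler_pdivlMr ?mulr_gt0 //.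
lra.
Qed.

(** * Duality *)

(** The weights as a sequence indexed by the naturals, which makes sums over
    initial segments and neighbouring values easy to write.  Beyond [n] it
    takes the value at [0], so that it is positive everywhere. *)
Definition wt {R : realFieldType} {n : nat} (pi : 'rV[R]_n.+1) (i : nat) : R :=
  pi 0 (inord i).

Lemma wtE {R : realFieldType} {n : nat} (pi : 'rV[R]_n.+1) (i : 'I_n.+1) :
  wt pi i = pi 0 i.
Proof. by rewrite /wt inord_val. Qed.

Lemma wt_gt0 {R : realFieldType} {n : nat} (pi : 'rV[R]_n.+1) :
  pos_pmf pi -> forall i, 0 < wt pi i.
Proof. by case=> pi_gt0 _ i; exact: pi_gt0. Qed.

(** The Siegmund dual of the kernel, in cumulative form: the probability of
    jumping from [k] into [{0, ..., i}] takes the same value at [k = i] and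
    [k = i + 1], because [1 - p_i = q_(i+1)].  This is what removes holding from
    the dual. *)
Lemma bd_kernel_cum {R : realFieldType} (n : nat) (pi : 'rV[R]_n.+1)
    (k i : 'I_n.+1) : pos_pmf pi -> (i < n)%N ->
  \sum_(j < n.+1 | (j <= i)%N) bd_kernel pi k j =
    if (k < i)%N then 1
    else if (k <= i.+1)%N then wt pi i / (wt pi i + wt pi i.+1) else 0.
Proof.
move=> pi_pmf lt_in; have w_gt0 := wt_gt0 pi pi_pmf.
have ltSi : (i.+1 < n.+1)%N by [].
have far (j : 'I_n.+1) : (k.+1 < j)%N || (j.+1 < k)%N -> bd_kernel pi k j = 0.
  move=> kj; rewrite mxE -val_eqE /=.
  by do 3![case: eqP => [?|_]; first lia].
have split1 : \sum_(j < n.+1 | (j <= i)%N) bd_kernel pi k j =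
    1 - \sum_(j < n.+1 | ~~ (j <= i)%N) bd_kernel pi k j.
  have := bd_kernel_row_sum k pi_pmf.
  by rewrite (bigID (fun j : 'I__ => j <= i)%N) /= => <-; rewrite addrK.
case: (ltnP k i) => [lt_ki|le_ik].
  by rewrite split1 big1 ?subr0 // => j nji; rewrite far //; apply/orP; lia.
move: le_ik; rewrite leq_eqVlt => /orP[/eqP eq_ik|lt_ik].
  rewrite -eq_ik leqnSn split1 (bigD1 (Ordinal ltSi)) /=; last by rewrite ltnn.
  rewrite big1 ?addr0 => [|j /andP[nji]]; last first.
    by rewrite -val_eqE /= => jNSi; rewrite far //; apply/orP; lia.
  rewrite mxE -val_eqE /= -eq_ik eqxx.
  have [-> ->] : (i.+2 == i) = false /\ (i.+1 == i) = false by lia.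
  rewrite /birth /pi_next -eq_ik lt_in -(wtE pi k) -eq_ik -/(wt pi i.+1).
  field; rewrite lt0r_neq0 // addr_gt0 //; exact: w_gt0.
case: ifP => [le_ki|nle_ki]; last first.
  by rewrite big1 // => j le_ji; rewrite far //; apply/orP; lia.
have Ek : k = i.+1 :> nat by lia.
rewrite (bigD1 i) //= big1 ?addr0 => [|j /andP[le_ji]]; last first.
  by rewrite -val_eqE /= => jNi; rewrite far //; apply/orP; lia.
by rewrite mxE Ek eqxx /death /pi_prev Ek /= -/(wt pi i) -(wtE pi k) Ek.
Qed.

Definition link {R : realFieldType} (n : nat) (w : nat -> R) : 'M[R]_n.+1 :=
  \matrix_(i, k) (if (k <= i)%N then w k / cum w i.+1 else 0).

(** By reversibility, the left-hand side at [(i, k)] is [w k / cum w i.+1] times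
    the probability of jumping from [k] into [{0, ..., i}], which
    [bd_kernel_cum] evaluates; for [i < n] the right-hand side has only the two
    terms [i - 1] and [i + 1], and at [i = n] both sides reduce to [w k]. *)
Lemma link_intertwines {R : realFieldType} (n : nat) (pi : 'rV[R]_n.+1) :
  pos_pmf pi ->
  link n (wt pi) *m bd_kernel pi =
  walk_mx n (dual_up (wt pi)) *m link n (wt pi).
Proof.
move=> pi_pmf; have w_gt0 := wt_gt0 pi pi_pmf.
apply/matrixP => i k; set w := wt pi.
have -> : (link n w *m bd_kernel pi) i k =
    w k / cum w i.+1 * \sum_(j < n.+1 | (j <= i)%N) bd_kernel pi k j.
  rewrite mxE mulr_sumr [RHS]big_mkcond; apply: eq_bigr => j _; rewrite mxE.
  case: ifP => _; last by rewrite mul0r.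
  by rewrite mulrAC /w wtE bd_kernel_reversible -wtE mulrAC.
rewrite mxE; case: (ltnP i n) => [lt_in|le_ni]; last first.
  have -> : i = ord_max by apply: val_inj; have := ltn_ord i; rewrite /=; lia.
  rewrite walk_mx_last mxE -ltnS ltn_ord (eq_bigl xpredT) => [|j].
    by rewrite bd_kernel_row_sum // mulr1.
  by rewrite -ltnS ltn_ord.
pose F l := if (k <= l)%N then w k / cum w l.+1 else 0.
have linkE l : link n w l k = F l by rewrite mxE.
under [RHS]eq_bigr do rewrite linkE.
rewrite (walk_mx_sum n _ i F) ?dual_up0 // bd_kernel_cum // dual_upC // /dual_up.
have := cumS_gt0 w i w_gt0; have := cumS_gt0 w i.+1 w_gt0.
have := w_gt0 i; have := w_gt0 i.+1; rewrite -/w => b0 a0 c2 c1.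
case: (posnP i) => [i0|i_gt0].
  rewrite /F i0 cum0 !mul0r addr0 /=.
  rewrite i0 in a0 b0 c1 c2; case: ifP => _; last by rewrite !mulr0.
  by field; rewrite !lt0r_neq0 // addr_gt0.
have := cumS_gt0 w i.-1 w_gt0; rewrite {1}prednK // => c0.
rewrite /F prednK //.
have -> : (k <= i.-1)%N = (k < i)%N by lia.
case: (ltnP k i) => [lt_ki|le_ik].
  have -> : (k <= i.+1)%N by lia.
  by field; rewrite !lt0r_neq0 // addr_gt0.
case: ifP => _; last by rewrite !mulr0 addr0.
by field; rewrite !lt0r_neq0 // addr_gt0.
Qed.

(** The intertwining passes to powers, and row [0] of [link] is the point mass
    at the initial state. *)
Lemma chain_law_dual {R : realFieldType} (n : nat) (pi : 'rV[R]_n.+1)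
    (t : nat) (k : 'I_n.+1) : pos_pmf pi ->
  chain_law (bd_kernel pi) ord0 t 0 k / pi 0 k =
  \sum_(i < n.+1 | (k <= i)%N)
     (walk_mx n (dual_up (wt pi)) ^+ t) ord0 i / cum (wt pi) i.+1.
Proof.
move=> pi_pmf; have w_gt0 := wt_gt0 pi pi_pmf.
set w := wt pi; set L := link n w; set P := walk_mx n _.
have comm : L *m bd_kernel pi ^+ t = P ^+ t *m L.
  elim: t => [|t IH]; first by rewrite !expr0 mulmx1 mul1mx.
  rewrite !exprS -![_ * _]/(_ *m _) mulmxA /L link_intertwines //.
  by rewrite -mulmxA IH mulmxA.
have -> : chain_law (bd_kernel pi) ord0 t = row ord0 (P ^+ t *m L).
  rewrite -comm row_mul; congr (_ *m _).
  apply/rowP => j; rewrite !mxE eqxx /= -val_eqE leqn0 /=.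
  case: eqP => // ->; rewrite cumS cum0 add0r divff //.
  by rewrite lt0r_neq0 // w_gt0.
rewrite !mxE mulr_suml [RHS]big_mkcond; apply: eq_bigr => i _.
rewrite mxE; case: ifP => _; last by rewrite mulr0 mul0r.
have w0 := w_gt0 k; have c0 := cumS_gt0 w i w_gt0; rewrite -wtE -/w.
by field; rewrite !lt0r_neq0.
Qed.

(** By [chain_law_dual], the likelihood ratio at any [k] contains the term
    [i = n], and at [k = n] it contains nothing else. *)
Lemma sep_chain_hit {R : realFieldType} (n : nat) (pi : 'rV[R]_n.+1)
    (t : nat) : pos_pmf pi ->
  sep_chain pi t = 1 - hit n (dual_up (wt pi)) t 0.
Proof.
move=> pi_pmf; have w_gt0 := wt_gt0 pi pi_pmf.
have p0 := dual_up0 _ w_gt0.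
have p01 j : (j < n)%N -> 0 <= dual_up (wt pi) j <= 1.
  by move=> _; exact: dual_up_bounds.
have cum_n : cum (wt pi) n.+1 = 1.
  by rewrite -(proj2 pi_pmf); apply: eq_bigr => i _; rewrite wtE.
have at_n : chain_law (bd_kernel pi) ord0 t 0 ord_max / pi 0 ord_max =
    hit n (dual_up (wt pi)) t 0.
  rewrite chain_law_dual // -(walk_mx_hit n _ t ord0) //.
  rewrite (big_pred1 ord_max) /= ?cum_n ?divr1 // => i.
  by rewrite [RHS]/= -val_eqE /=; have := ltn_ord i; lia.
have min_n k : hit n (dual_up (wt pi)) t 0 <=
    chain_law (bd_kernel pi) ord0 t 0 k / pi 0 k.
  rewrite chain_law_dual // -(walk_mx_hit n _ t ord0) //.
  rewrite (bigD1 ord_max) /=; last by rewrite -ltnS.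
  rewrite cum_n divr1 lerDl; apply: sumr_ge0 => i _.
  by rewrite divr_ge0 ?walk_mx_exp_ge0 // ltW // cumS_gt0.
apply/le_anti/andP; split.
  by apply: bigmax_le => [|i _]; rewrite lerD2l lerN2.
by rewrite -at_n /sep_chain /separation;
  exact: (le_bigmax _ (fun i => 1 - chain_law _ _ _ 0 i / pi 0 i) ord_max).
Qed.

Lemma dual_up_uniform {R : realFieldType} (n i : nat) :
  dual_up (wt (uniform_pmf R n)) i = i.+2%:R / (2 * i.+1%:R).
Proof.
have wE j : wt (uniform_pmf R n) j = n.+1%:R^-1 by rewrite /wt mxE.
have cumE j : cum (wt (uniform_pmf R n)) j = j%:R / n.+1%:R.
  by rewrite /cum; under eq_bigr do rewrite wE; rewrite sumr_const card_ord mulr_natl.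
rewrite /dual_up !cumE !wE; field.
by rewrite !nat1r !pnatr_eq0.
Qed.

Theorem theorem5p9 (R : realFieldType) (n : nat) (n_gt0 : (0 < n)%N)
    (pi : 'rV[R]_n.+1) (pi_pmf : pos_pmf pi) (pi_lc : log_concave pi)
    (t : nat) :
  sep_chain pi t <= sep_chain (uniform_pmf R n) t.
Proof.
have U_pmf := uniform_pos_pmf R n.
have w_gt0 := wt_gt0 pi pi_pmf.
have u_gt0 := wt_gt0 _ U_pmf.
have w_lc j : (j.+2 <= n)%N -> wt pi j * wt pi j.+2 <= wt pi j.+1 ^+ 2.
  move=> ltj; have Ej : (inord j.+1 : 'I_n.+1) = j.+1 :> nat.
    by rewrite inordK // ltnW.
  have := pi_lc (inord j.+1); rewrite /pi_prev /pi_next Ej /=.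
  by rewrite ltj; apply.
rewrite !sep_chain_hit // lerD2l lerN2.
apply: hit_le; rewrite ?dual_up0 // => j lt_jn; try exact: dual_up_bounds.
rewrite dual_up_uniform; exact: (dual_up_log_concave _ n).
Qed.
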